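(* Let $F$ be a totally real number field, let $L$ be an $\mathcal{O}_F$-lattice, and let $d,m$ be positive integers. There are at most finitely many totally real number fields $K\supset F$ of degree $d=[K:\mathbb{Q}]$ such that the $\mathcal{O}_K$-lattice $L\otimes\mathcal{O}_K$ represents all elements of $m\mathcal{O}_K^+$.
   Context: For a number field $F$, $\mathcal{O}_F$ is its ring of integers; number fields are considered inside a fixed algebraic closure of $\mathbb{Q}$. For a totally real number field $F$, an element $\alpha\in F$ is totally positive ($\alpha\succ 0$) if $\sigma(\alpha)>0$ for every embedding $\sigma:F\hookrightarrow\mathbb{R}$; $\mathcal{O}_F^+$ is the set of totally positive elements of $\mathcal{O}_F$, and $m\mathcal{O}_F^+=\{m\alpha:\alpha\in\mathcal{O}_F^+\}$. Let $V$ be an $r$-dimensional quadratic space over $F$ with symmetric bilinear form $B:V\times V\to F$ and quadratic form $Q(v)=B(v,v)$. An $\mathcal{O}_F$-lattice $L=(L,Q)$ (of rank $r$) is a finitely generated $\mathcal{O}_F$-submodule $L\subset V$ with $FL=V$, equipped with the restrictions of $B$ and $Q$; it is always assumed that $Q$ is totally positive definite ($Q(v)\succ 0$ for all nonzero $v\in V$) and that $Q(v)\in\mathcal{O}_F$ for all $v\in L$. $L$ represents $\alpha$ if there is $v\in L$ with $Q(v)=\alpha$. Writing $L=\mathfrak{a}_1v_1+\cdots+\mathfrak{a}_rv_r$ for a basis $v_1,\dots,v_r$ of $V$ and fractional ideals $\mathfrak{a}_i$ of $F$, for a field extension $K\supset F$ the $\mathcal{O}_K$-lattice $L\otimes\mathcal{O}_K$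 is $\mathcal{O}_K\mathfrak{a}_1v_1+\cdots+\mathcal{O}_K\mathfrak{a}_rv_r$, equipped with the natural ($K$-bilinear, resp. quadratic) extensions of $B$ and $Q$. *)

(* Defs.v *)
From HB Require Import structures.
From mathcomp Require Import all_boot all_order all_algebra all_field.
From mathcomp Require Import boolp classical_sets cardinality.

Set Implicit Arguments.
Unset Strict Implicit.
Unset Printing Implicit Defensive.

Import GRing.Theory Num.Theory.

Local Open Scope classical_set_scope.
Local Open Scope ring_scope.

(* A number field is a [fieldExtType rat], its degree over Q is [\dim {:F}],
   and [algC] is the fixed algebraic closure of Q.  Every embedding of a number
   field into the complex numbers takes its values in [algC], and it is an
   embedding into the real numbers when these values are real. *)

Section NumberField.
Variable F : fieldExtType rat.

Definition integers : set F := [set x | integralOver (intr : int -> F) x].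

Definition real_embedding (s : {rmorphism F -> algC}) : Prop :=
  forall x, s x \is Num.real.

Definition totally_real : Prop :=
  forall s : {rmorphism F -> algC}, real_embedding s.

Definition totally_positive (x : F) : Prop :=
  forall s : {rmorphism F -> algC}, real_embedding s -> 0 < s x.

Definition positive_integers : set F :=
  [set x | integers x /\ totally_positive x].

End NumberField.

Arguments integers F : clear implicits.
Arguments positive_integers F : clear implicits.

(* Finite combinations of elements of S with coefficients in A. *)
Definition combinations (F : fieldType) (V : lmodType F)
    (A : set F) (S : set V) : set V :=
  [set w | exists n (c : 'I_n -> F) (u : 'I_n -> V),
     [/\ forall i, A (c i), forall i, S (u i) & w = \sum_i c i *: u i]].

Definition fg_module (F : fieldExtType rat) (V : lmodType F) (M : set V) :
    Prop :=
  exists s : seq V, M = combinations (integers F) [set` s].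

Definition fractional_ideal (F : fieldExtType rat) (I : set F) : Prop :=
  fg_module (I : set F^o) /\ exists2 x, I x & x != 0.

Definition represents (F V : Type) (B : V -> V -> F) (L : set V) (a : F) :
    Prop :=
  exists2 v, L v & B v v = a.

Record is_lattice (F : fieldExtType rat) (V : vectType F)
    (B : {symmetric V}) (L : set V) : Prop := IsLattice {
  lattice_fg : fg_module L;
  lattice_full : combinations setT L = setT;
  lattice_posdef : forall v : V, v != 0 -> totally_positive (B v v);
  lattice_integral : forall v : V, L v -> integers F (B v v)
}.

Section ScalarExtension.
Variables (F K : fieldExtType rat) (h : {rmorphism F -> K}).
Variables (V : vectType F) (B : {symmetric V}).

(* The extension V_K of V to K is the space of K-coordinates relative to the
   F-basis [vbasis {:V}] of V. *)
Local Notation e := (vbasis {:V}).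
Local Notation VK := 'rV[K]_(\dim {:V}).

Definition ext_vec (v : V) : VK := \row_i h (coord e i v).

Definition ext_form (x y : VK) : K :=
  \sum_i \sum_j x 0 i * y 0 j * h (B e`_i e`_j).

Lemma ext_formE (v w : V) : ext_form (ext_vec v) (ext_vec w) = h (B v w).
Proof.
rewrite {2}(coord_vbasis (memvf v)) {2}(coord_vbasis (memvf w)).
rewrite linear_sumlz rmorph_sum; apply: eq_bigr => i _ /=.
rewrite linear_sumr rmorph_sum; apply: eq_bigr => j _ /=.
by rewrite linearZl_LR linearZr_LR /= !rmorphM !mxE mulrA.
Qed.

Definition ext_ideal (I : set F) : set K :=
  combinations (integers K) (h @` I : set K^o).

Definition pseudo_basis (L : set V) (I : 'I_(\dim {:V}) -> set F)
    (v : (\dim {:V}).-tuple V) : Prop :=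
  [/\ forall i, fractional_ideal (I i), basis_of {:V} v &
      L = [set w | exists2 x : 'I_(\dim {:V}) -> F,
             forall i, I i (x i) & w = \sum_i x i *: v`_i]].

(* Every lattice has a pseudo-basis (Steinitz), and the module obtained does
   not depend on it: it is the O_K-span of L in V_K. *)
Definition ext_lattice (L : set V) : set VK :=
  [set w | exists (I : 'I_(\dim {:V}) -> set F) (v : (\dim {:V}).-tuple V),
     pseudo_basis L I v /\
     exists2 x : 'I_(\dim {:V}) -> K,
       forall i, ext_ideal (I i) (x i) & w = \sum_i x i *: ext_vec v`_i].

End ScalarExtension.

Definition represents_all_multiples (F K : fieldExtType rat)
    (h : {rmorphism F -> K}) (V : vectType F) (B : {symmetric V}) (L : set V)
    (m : nat) : Prop :=
  [set m%:R * a | a in positive_integers K] `<=`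
    represents (ext_form h B) (ext_lattice h L).

(* Main.v *)
Require Import Defs.
From HB Require Import structures.
From mathcomp Require Import all_boot all_order all_algebra all_field.
From mathcomp Require Import finmap.
From mathcomp Require Import boolp classical_sets cardinality.

Set Implicit Arguments.
Unset Strict Implicit.
Unset Printing Implicit Defensive.

Import Order.TTheory GRing.Theory Num.Theory.

Local Open Scope classical_set_scope.
Local Open Scope ring_scope.

(** Why the theorem holds. An algebraic integer of degree at most d all of whose
    conjugates have absolute value at most X lies in a finite set
    (Northcott, [bounded_integers_finite]). So it suffices to find X, depending
    only on F, L, d and m, such that every field K under consideration is
    generated over F by its integers of that kind: K is then determined by the
    finite set of those integers, and a finite set has finitely many subsets.

    To find X, write the form as a combination of squares of linear forms,
    [B v v = \sum_f (B f f)^-1 * B f v ^+ 2] for an F-basis of orthogonal vectors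
    f ([orthogonal_expansion]). The coefficients are totally positive, and the
    numbers [N * B f v] with v in L are integral for one fixed N
    ([lattice_common_denominator]). All of this persists on the extension of L
    to K ([ext_form_expansion], [ext_lattice_pairing]).

    Now let x be an integer of K whose conjugates are bounded by n. Then
    [x + n + 1] is totally positive, so [m * (x + n + 1)] is represented, that is,
    it equals [\sum_f c_f * y_f ^+ 2] with c_f in F totally positive and y_f
    integral. In each real embedding every term is at most the sum, so the
    conjugates of y_f are of order the square root of n; once n is large they are
    at most [n - 1] ([descent]). By induction on n, x is a rational expression in
    elements of F and integers of K with small conjugates
    ([generated_by_bounded_integers]). *)

(** * Conjugates of algebraic numbers *)

Lemma map_in_alg_ratr (K : fieldExtType rat) (s : {rmorphism K -> algC})
    (p : {poly rat}) : map_poly s (map_poly (in_alg K) p) = map_poly ratr p.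
Proof.
rewrite -map_poly_comp; apply: eq_map_poly => a.
by rewrite /= rmorphZ_num rmorph1 mulr1.
Qed.

(** The roots of the minimal polynomial of z generate a splitting field; the
    isomorphism from Q(z) to Q(r) extends to that field, and from there to the
    algebraic closure. *)
Lemma conjugate_aut (z r : algC) :
  root (minCpoly z) r -> exists nu : {rmorphism algC -> algC}, nu z = r.
Proof.
have [p [Dp mon_p] dv_p] := minCpolyP z.
have [rs Drs] := closed_field_poly_normal (minCpoly z).
rewrite (monicP (minCpoly_monic z)) scale1r in Drs.
have [Qs [QsC [rs1 Drs1 genQs]]] := num_field_exists rs.
have inQs y : root (minCpoly z) y -> exists y1, QsC y1 = y.
  rewrite Drs root_prod_XsubC -Drs1 => /mapP[y1 _ ->].
  by exists y1.
have [z1 Dz1] := inQs _ (root_minCpoly z).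
move=> /[dup] rr /inQs[r1 Dr1].
pose pr := map_poly (in_alg Qs) p.
have Qpr : pr \is a polyOver 1%VS.
  by apply/polyOver1P; exists p.
have Dpr : pr = \prod_(y <- rs1) ('X - y%:P).
  apply: (map_poly_inj QsC).
  rewrite map_in_alg_ratr -Dp Drs -Drs1 big_map rmorph_prod /=.
  by apply: eq_bigr => y _; rewrite map_polyXsubC.
have hom1 : kHom 1 1 (\1%VF : 'End(Qs)) by rewrite kHom1.
have r1_root : root (map_poly \1%VF (minPoly 1 z1)) r1.
  rewrite map_poly_id => [|a _]; last by rewrite id_lfunE.
  have /polyOver1P[q Dq] := minPolyOver 1 z1.
  rewrite -(fmorph_root QsC) Dr1 Dq map_in_alg_ratr.
  have : root (map_poly ratr q) z.
    by rewrite -Dz1 -(map_in_alg_ratr QsC) -Dq fmorph_root root_minPoly.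
  rewrite dv_p => /dvdpP[q1 ->].
  by rewrite rmorphM rootM /= -Dp rr orbT.
have homz := kHomExtendP (subvv _) hom1 r1_root.
have splitQs : splittingFieldFor <<1; z1>>%AS pr fullv.
  apply: (splittingFieldForS (sub1v _) (subvf _)).
  by exists rs1 => //; rewrite Dpr eqpxx.
have [f homf Df] := kHom_extends (sub1v <<1; z1>>%AS) homz Qpr splitQs.
pose fM := GRing.isMonoidMorphism.Build _ _ f (kHom_monoid_morphism homf).
pose fR : {rmorphism _ -> _} := HB.pack (fun_of_lfun f) fM.
have [nu Dnu] := extend_algC_subfield_aut QsC fR.
exists nu; rewrite -Dz1 -Dnu /= -Df ?memv_adjoin //.
by rewrite (kHomExtend_val hom1).
Qed.

(** * Finiteness of the integers of bounded degree and conjugates *)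

(** Multiplying by X - r turns the coefficients c_i into c_(i-1) - r c_i, so it
    multiplies a common bound by at most n + 1. *)
Lemma coef_prod_XsubC_bound (n : nat) (rs : seq algC) i :
  {in rs, forall r, `|r| <= n%:R} ->
  `|(\prod_(r <- rs) ('X - r%:P))`_i| <= (n.+1 ^ size rs)%:R.
Proof.
elim: rs i => [|r rs IHrs] i rs_n.
  by rewrite big_nil coef1 normr_nat ler_nat leq_b1.
have {}IHrs k := IHrs k (fun y ys => rs_n y (mem_behead (s := r :: rs) ys)).
rewrite big_cons mulrBl coefB coefXM coefCM expnS mulSn natrD natrM.
apply: (le_trans (ler_normB _ _)); rewrite lerD //; last first.
  by rewrite normrM ler_pM ?rs_n ?mem_head.
by case: i => [|i] /=; rewrite ?normr0 ?ler0n.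
Qed.

Definition bounded_integers (d n : nat) : set algC :=
  [set z | [/\ z \in Aint, (size (minCpoly z) <= d.+1)%N &
               forall r, root (minCpoly z) r -> `|r| <= n%:R]].

(** The minimal polynomial of such an integer has integer coefficients, and these
    are bounded as symmetric functions of the bounded roots, so only finitely
    many polynomials occur. *)
Lemma bounded_integers_finite (d n : nat) : finite_set (bounded_integers d n).
Proof.
pose M := (n.+1 ^ d)%N.
(* The integers in [-M, M] are encoded as k - M with k <= 2 M. *)
pose p_ (f : {ffun 'I_d.+1 -> 'I_(M + M).+1}) : {poly algC} :=
  \poly_(i < d.+1) ((f (inord i))%:R - M%:R).
pose rs_ f := sval (closed_field_poly_normal (p_ f)).
apply: (@sub_finite_set _ _ (\bigcup_(f in setT) [set` rs_ f])); last first.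
  by apply: bigcup_finite => // f _; apply: finite_seq.
move=> z [/polyOverP intz szz rz].
have [rs Drs] := closed_field_poly_normal (minCpoly z).
rewrite (monicP (minCpoly_monic z)) scale1r in Drs.
have coefM i : `|(minCpoly z)`_i| <= M%:R.
  rewrite Drs; apply: le_trans (coef_prod_XsubC_bound _ (n := n) _) _ => [r rrs|].
    by apply: rz; rewrite Drs root_prod_XsubC.
  rewrite ler_nat leq_pexp2l // -ltnS.
  by move: szz; rewrite Drs size_prod_XsubC.
have /boolp.choice[f Df] : forall i : 'I_d.+1, exists k : 'I_(M + M).+1,
    (minCpoly z)`_i = k%:R - M%:R.
  move=> i; have := coefM i.
  rewrite real_ler_norml ?Rreal_int // => /andP[ge_M le_M].
  have : (minCpoly z)`_i + M%:R \in Num.nat.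
    by rewrite natrEint rpredD ?rpred_nat ?intz //= -lerBlDr sub0r.
  case/natrP => k Dk.
  have ltk : (k < (M + M).+1)%N.
    by rewrite ltnS -(ler_nat algC) -Dk natrD lerD2r.
  by exists (Ordinal ltk); rewrite -Dk addrK.
exists [ffun i => f i] => //=.
have Dpf : p_ [ffun i => f i] = minCpoly z.
  apply/polyP => i; rewrite coef_poly; case: ltnP => [lti|gei].
    by rewrite ffunE -Df inordK.
  by rewrite nth_default // (leq_trans szz).
have := root_minCpoly z; rewrite -Dpf /rs_.
case: closed_field_poly_normal => s /= ->.
by rewrite rootZ ?root_prod_XsubC // Dpf lead_coef_eq0 minCpoly_eq0.
Qed.

(** * Integers and embeddings of a number field *)

Lemma homogenize_term (R : comNzRingType) (c b y : R) i n : (i <= n)%N ->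
  c * b ^+ (n - i) * (b * y) ^+ i = c * y ^+ i * b ^+ n.
Proof.
move=> le_in; rewrite exprMn mulrA -[_ * _ * b ^+ i]mulrA -exprD subnK //.
by rewrite mulrAC.
Qed.

Section NumberFieldFacts.
Variables (K : fieldExtType rat) (j : {rmorphism K -> algC}).

Lemma integers_Aint x : integers K x -> j x \in Aint.
Proof.
case=> p mon_p px0.
have Dp : map_poly j (map_poly intr p) = map_poly (intr : int -> algC) p.
  by rewrite -map_poly_comp; apply: eq_map_poly => a; rewrite /= rmorph_int.
apply: (@root_monic_Aint (map_poly intr p)); first by rewrite -Dp fmorph_root.
  exact: monic_map.
by apply/polyOverP => i; rewrite coef_map /= rpred_int.
Qed.

Lemma conjugate_embedding x r :
  root (minCpoly (j x)) r -> exists s : {rmorphism K -> algC}, s x = r.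
Proof. by case/conjugate_aut=> nu <-; exists (nu \o j). Qed.

Lemma size_minCpoly_leq x : (size (minCpoly (j x)) <= (\dim {:K}).+1)%N.
Proof.
have [p [-> _] dv_p] := minCpolyP (j x).
have /polyOver1P[q Dq] := minPolyOver 1 x.
have : root (map_poly ratr q) (j x).
  by rewrite -(map_in_alg_ratr j) -Dq fmorph_root root_minPoly.
rewrite dv_p size_map_poly => /dvdp_leq le_pq; apply: (leq_trans (le_pq _)).
  apply/eqP => q0; have := monic_minPoly 1 x.
  by rewrite Dq q0 rmorph0 monicE lead_coef0 eq_sym oner_eq0.
rewrite -(size_map_poly (in_alg K)) -Dq size_minPoly ltnS.
by rewrite adjoin_degreeE dimv1 divn1 dimvS ?subvf.
Qed.

(** All the images of x are among the roots of one rational polynomial. *)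
Lemma embeddings_bounded x :
  exists n : nat, forall s : {rmorphism K -> algC}, `|s x| <= n%:R.
Proof.
have /polyOver1P[q Dq] := minPolyOver 1 x.
have [rs Drs] := closed_field_poly_normal (map_poly ratr q : {poly algC}).
have q_neq0 : q != 0.
  apply/eqP => q0; have := monic_minPoly 1 x.
  by rewrite Dq q0 rmorph0 monicE lead_coef0 eq_sym oner_eq0.
exists (Num.bound (\sum_(r <- rs) `|r|)) => s.
have : root (map_poly ratr q) (s x).
  by rewrite -(map_in_alg_ratr s) -Dq fmorph_root root_minPoly.
rewrite Drs rootZ; last by rewrite lead_coef_eq0 map_poly_eq0.
rewrite root_prod_XsubC => sx_rs.
apply: (@le_trans _ _ (\sum_(r <- rs) `|r|)).
  by rewrite (big_rem (s x)) //= lerDl sumr_ge0.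
by apply/ltW/archi_boundP; rewrite sumr_ge0.
Qed.

Lemma integers0 : integers K 0. Proof. exact: integral0. Qed.
Lemma integersD x y : integers K x -> integers K y -> integers K (x + y).
Proof. exact: integral_add. Qed.
Lemma integersM x y : integers K x -> integers K y -> integers K (x * y).
Proof. exact: integral_mul. Qed.
Lemma integers_nat n : integers K n%:R.
Proof. exact: integral_nat. Qed.

Lemma integers_sum (I : Type) (r : seq I) (P : pred I) (E : I -> K) :
  (forall i, P i -> integers K (E i)) -> integers K (\sum_(i <- r | P i) E i).
Proof.
by move=> EP; elim/big_ind: _ => //; [apply: integers0 | apply: integersD].
Qed.

(** If a is a common denominator of the coefficients of the minimal polynomial
    p of x, of degree n, then a x is a root of the monic polynomial
    a ^ n p(X / a), whose coefficients are integers. *)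
Lemma integral_multiple x : exists2 N : nat, (0 < N)%N & integers K (N%:R * x).
Proof.
have /polyOver1P[p Dp] := minPolyOver 1 x.
have mon_p : p \is monic.
  by have := monic_minPoly 1 x; rewrite Dp map_monic.
have [q [a a_neq0 Dq]] := rat_poly_scale p.
pose n := (size p).-1.
have szp : size p = n.+1 by rewrite polySpred ?monic_neq0.
pose P : {poly K} := \poly_(i < n.+1) (in_alg K p`_i * a%:~R ^+ (n - i)).
have pn : p`_n = 1 by rewrite -[n]/((size p).-1) -lead_coefE (monicP mon_p).
have Pn : P`_n = 1 by rewrite coef_poly ltnSn subnn mulr1 pn rmorph1.
have szP : size P = n.+1.
  by rewrite size_poly_eq // subnn mulr1 pn rmorph1 oner_eq0.
have mon_P : P \is monic by rewrite monicE lead_coefE szP /= Pn.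
have root_P : root P (a%:~R * x).
  rewrite rootE horner_poly.
  under eq_bigr => i _ do rewrite homogenize_term -1?ltnS //.
  rewrite -mulr_suml.
  have /rootP := root_minPoly 1 x; rewrite Dp horner_coef size_map_poly szp => Dx.
  suff -> : \sum_(i < n.+1) in_alg K p`_i * x ^+ i = 0 by rewrite mul0r.
  by rewrite -[RHS]Dx; apply: eq_bigr => i _; rewrite coef_map.
have int_ax : integers K (a%:~R * x).
  apply: (integral_root_monic mon_P root_P) => c /(nthP 0)[i ltiP <-].
  move: ltiP; rewrite szP ltnS leq_eqVlt => /predU1P[->|lt_in].
    by rewrite Pn; apply: integral1.
  rewrite coef_poly ltnS (ltnW lt_in) -(subnSK lt_in) exprS Dq coefZ coef_map.
  rewrite rmorphM fmorphV !rmorph_int mulrCA mulrA mulrA mulfV ?mul1r; last first.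
    by rewrite -(rmorph_int (in_alg K)) fmorph_eq0 intr_eq0.
  by rewrite -rmorphXn; apply: integral_mul; apply: integral_id.
exists `|a|%N; first by rewrite absz_gt0.
rewrite pmulrn abszE; case: (ger0P a) => _ //.
by rewrite rmorphN mulNr; apply: integral_opp.
Qed.
End NumberFieldFacts.

Lemma integers_morph (F K : fieldExtType rat) (h : {rmorphism F -> K}) x :
  integers F x -> integers K (h x).
Proof.
case=> p mon_p px0; exists p => //.
have <- : map_poly h (map_poly intr p) = map_poly (intr : int -> K) p.
  by rewrite -map_poly_comp; apply: eq_map_poly => b; rewrite /= rmorph_int.
by rewrite fmorph_root.
Qed.

Section CommonMultiples.
Variable F : fieldExtType rat.

Lemma common_integral_multiple (xs : seq F) :
  exists2 N : nat, (0 < N)%N & {in xs, forall x, integers F (N%:R * x)}.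
Proof.
elim: xs => [|x xs [N N_gt0 NP]]; first by exists 1%N.
have [M M_gt0 MP] := integral_multiple x.
exists (M * N)%N; first by rewrite muln_gt0 M_gt0.
move=> y; rewrite inE natrM => /predU1P[->|/NP Ny].
  by rewrite mulrAC mulrC; apply: integersM => //; apply: integers_nat.
by rewrite -mulrA; apply: integersM => //; apply: integers_nat.
Qed.

Lemma common_embeddings_bound (xs : seq F) : exists C : nat,
  {in xs, forall x, forall s : {rmorphism F -> algC}, `|s x| <= C%:R}.
Proof.
elim: xs => [|x xs [C CP]]; first by exists 0%N.
have [n nP] := embeddings_bounded x.
exists (n + C)%N => y; rewrite inE natrD => /predU1P[->|/CP yC] s.
  by rewrite (le_trans (nP s)) // lerDl ler0n.
by rewrite (le_trans (yC s)) // lerDr ler0n.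
Qed.
End CommonMultiples.

(** * Orthogonal expansion of an anisotropic symmetric form *)

Section OrthogonalExpansion.
Variables (F : fieldType) (V : vectType F) (B : {symmetric V}).
Hypothesis anisotropic : forall v, v != 0 -> B v v != 0.

Lemma symmetricC v w : B v w = B w v.
Proof. by rewrite hermC expr0 mul1r. Qed.

(** Gram-Schmidt, skipping the vectors that depend on the previous ones. The
    last clause says that the orthogonal family spans [us], in the form that
    gives the coordinates. *)
Lemma gram_schmidt (us : seq V) : exists s : seq V,
  [/\ uniq s, {in s, forall f, f != 0},
      {in s &, forall f g, f != g -> B f g = 0} &
      {in us, forall u, u = \sum_(f <- s) (B f u / B f f) *: f}].
Proof.
elim: us => [|u us [s [uniq_s nz_s orth_s exp_s]]]; first by exists [::].
pose g := u - \sum_(f <- s) (B f u / B f f) *: f.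
have orth_g : {in s, forall f, B f g = 0}.
  move=> f fs; rewrite linearBr linear_sumr /= (bigD1_seq f) //= linearZr_LR /=.
  rewrite divfK ?anisotropic ?nz_s // big_seq_cond big1 ?addr0 ?subrr //.
  move=> f' /andP[f's]; rewrite eq_sym => ff'.
  by rewrite linearZr_LR /= (orth_s f f') ?mulr0.
have Du : u = g + \sum_(f <- s) (B f u / B f f) *: f by rewrite subrK.
have [g0|nz_g] := eqVneq g 0.
  exists s; split=> // v; rewrite inE => /predU1P[->|/exp_s//].
  by rewrite {1}Du g0 add0r.
have gs : g \notin s.
  by apply: contraL (anisotropic nz_g) => gs; rewrite orth_g ?eqxx.
exists (g :: s); split.
- by rewrite /= gs.
- by move=> f; rewrite inE => /predU1P[->|/nz_s].
- move=> f f'; rewrite !inE => /predU1P[->|fs] /predU1P[->|f's] //.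
  + by rewrite eqxx.
  + by move=> _; rewrite symmetricC orth_g.
  + by move=> _; rewrite orth_g.
  + exact: orth_s.
have g_comb v : B g (\sum_(f <- s) (B f v / B f f) *: f) = 0.
  rewrite linear_sumr big_seq big1 // => f fs.
  by rewrite linearZr_LR /= (symmetricC g) orth_g ?mulr0.
move=> v; rewrite inE big_cons => /predU1P[->|/exp_s Dv].
  by rewrite {1 2}Du linearDr /= g_comb addr0 divff ?anisotropic ?scale1r.
by rewrite {2}Dv g_comb mul0r scale0r add0r.
Qed.

(** The coordinates of v in an orthogonal basis are [B f v / B f f]. *)
Lemma orthogonal_expansion : exists2 s : seq V, {in s, forall f, f != 0} &
  forall v w, B v w = \sum_(f <- s) (B f f)^-1 * (B f v * B f w).
Proof.
have [s [_ nz_s _ exp_s]] := gram_schmidt (vbasis {:V}).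
exists s => // v w.
have {1}-> : v = \sum_(f <- s) (B f v / B f f) *: f.
  rewrite {1}(coord_vbasis (memvf v)).
  under eq_bigr => i _.
    rewrite {1}(exp_s (vbasis {:V})`_i); last by rewrite mem_nth ?size_tuple.
    rewrite scaler_sumr; over.
  rewrite exchange_big /=; apply: eq_bigr => f _.
  rewrite [in RHS](coord_vbasis (memvf v)) linear_sumr mulr_suml scaler_suml.
  by apply: eq_bigr => i _; rewrite linearZr_LR /= scalerA mulrA.
rewrite linear_sumlz; apply: eq_bigr => f _.
by rewrite linearZl_LR /= mulrAC mulrC.
Qed.
End OrthogonalExpansion.

(** * The lattice and its extension of scalars *)

(** It is enough to clear the denominators of the finitely many values [B f g],
    with g among the generators of L. *)
Lemma lattice_common_denominator (F : fieldExtType rat) (V : vectType F)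
    (B : {symmetric V}) (L : set V) (s : seq V) :
  fg_module L -> exists2 N : nat, (0 < N)%N &
    {in s, forall f v, L v -> integers F (N%:R * B f v)}.
Proof.
case=> gens ->.
have [N N_gt0 NP] := common_integral_multiple [seq B f g | f <- s, g <- gens].
exists N => // f fs _ [n [c [u [cint ugens ->]]]].
rewrite linear_sumr mulr_sumr; apply: integers_sum => i _.
rewrite linearZr_LR /= mulrCA; apply: integersM => //.
by apply: NP; apply/allpairsP; exists (f, u i); split=> //; apply: ugens.
Qed.

Lemma combinations0 (F : fieldType) (V : lmodType F) (A : set F) (S : set V) :
  combinations A S 0.
Proof.
have f : forall T, 'I_0 -> T by move=> T [].
exists 0%N, (f F), (f V); split; [by case | by case | by rewrite big_ord0].
Qed.

Section ScalarExtension.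
Variables (F K : fieldExtType rat) (h : {rmorphism F -> K}).
Variables (V : vectType F) (B : {symmetric V}).
Local Notation e := (vbasis {:V}).
Local Notation VK := 'rV[K]_(\dim {:V}).

(** The pairing of [ext_vec h f] with x under the extended form. *)
Definition ext_pairing (f : V) (x : VK) : K := \sum_i x 0 i * h (B f e`_i).

Lemma ext_pairing_vec f v : ext_pairing f (ext_vec h v) = h (B f v).
Proof.
rewrite [in RHS](coord_vbasis (memvf v)) linear_sumr rmorph_sum.
by apply: eq_bigr => i _; rewrite linearZr_LR /= rmorphM mxE.
Qed.

Lemma ext_pairing_comb f (I : Type) (r : seq I) (c : I -> K) (x : I -> VK) :
  ext_pairing f (\sum_(k <- r) c k *: x k) =
    \sum_(k <- r) c k * ext_pairing f (x k).
Proof.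
rewrite /ext_pairing.
under [RHS]eq_bigr => k _ do rewrite mulr_sumr.
rewrite exchange_big /=; apply: eq_bigr => i _.
rewrite summxE mulr_suml; apply: eq_bigr => k _.
by rewrite mxE mulrA.
Qed.

Lemma ext_form_expansion (s : seq V) :
  (forall v w, B v w = \sum_(f <- s) (B f f)^-1 * (B f v * B f w)) ->
  forall x, ext_form h B x x = \sum_(f <- s) h (B f f)^-1 * ext_pairing f x ^+ 2.
Proof.
move=> expB x; rewrite /ext_form.
under eq_bigr => i _ do under eq_bigr => j _ do
  rewrite expB rmorph_sum mulr_sumr.
under eq_bigr => i _ do rewrite exchange_big /=.
rewrite exchange_big /=; apply: eq_bigr => f _.
rewrite expr2 {1}/ext_pairing mulr_suml mulr_sumr; apply: eq_bigr => i _.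
rewrite /ext_pairing !mulr_sumr; apply: eq_bigr => k _.
by rewrite !rmorphM /= mulrCA; congr (_ * _); rewrite mulrACA.
Qed.

(** A vector of the extended lattice is an O_K-combination of vectors of L, so
    an integrality bound on L carries over. *)
Lemma ext_lattice_pairing (L : set V) (N : nat) (f : V) (x : VK) :
  (forall v, L v -> integers F (N%:R * B f v)) -> ext_lattice h L x ->
  integers K (N%:R * ext_pairing f x).
Proof.
move=> intL [I [v [[frI _ DL] [c cI ->]]]].
rewrite ext_pairing_comb mulr_sumr; apply: integers_sum => i _.
have I0 k : I k 0 by case: (frI k) => [[s ->] _]; apply: combinations0.
have [n [a [u [aint uI Dc]]]] := cI i.
rewrite ext_pairing_vec Dc mulr_suml mulr_sumr; apply: integers_sum => k _.
have [t It Dt] := uI k.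
rewrite -Dt /= -mulrA mulrCA; apply: integersM => //.
rewrite -rmorphM -(rmorph_nat h) -rmorphM; apply: integers_morph.
have -> : t * B f v`_i = B f (t *: v`_i) by rewrite linearZr_LR.
(* The product of t in I_i with the i-th vector of the pseudo-basis is in L. *)
apply: intL; rewrite DL /=.
exists (fun i' => if i' == i then t else 0).
  by move=> i'; case: eqP => [->|].
rewrite (bigD1 i) //= eqxx big1 ?addr0 // => i' /negbTE->.
by rewrite scale0r.
Qed.
End ScalarExtension.

(** * Subfields generated by a set of algebraic numbers *)

Inductive field_generated (S : set algC) : set algC :=
| generated_mem z : S z -> field_generated S z
| generated_one : field_generated S 1
| generated_sub x y :
    field_generated S x -> field_generated S y -> field_generated S (x - y)
| generated_mul x y :
    field_generated S x -> field_generated S y -> field_generated S (x * y)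
| generated_inv x : field_generated S x -> field_generated S x^-1.

Section GeneratedField.
Variable S : set algC.
Local Notation G := (field_generated S).

Lemma generated_zero : G 0.
Proof. by rewrite -(subrr 1); apply: generated_sub; apply: generated_one. Qed.

Lemma generated_add x y : G x -> G y -> G (x + y).
Proof.
move=> Gx Gy; rewrite -[y]opprK -[- y]add0r.
by do 2?[apply: generated_sub => //]; apply: generated_zero.
Qed.

Lemma generated_nat n : G n%:R.
Proof.
elim: n => [|n IHn]; first exact: generated_zero.
by rewrite -addn1 natrD; apply: generated_add => //; apply: generated_one.
Qed.

Lemma generated_sum (I : eqType) (r : seq I) (E : I -> algC) :
  {in r, forall i, G (E i)} -> G (\sum_(i <- r) E i).
Proof.
move=> GE; rewrite big_seq; elim/big_ind: _ => //; first exact: generated_zero.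
exact: generated_add.
Qed.
End GeneratedField.

Lemma field_generated_range (K : fieldExtType rat) (j : {rmorphism K -> algC})
    (S : set algC) : S `<=` range j -> field_generated S `<=` range j.
Proof.
move=> Sj z0; elim=> [z /Sj//||x y _ [x1 _ <-] _ [y1 _ <-]
                     |x y _ [x1 _ <-] _ [y1 _ <-]|x _ [x1 _ <-]].
- by exists 1; rewrite ?rmorph1.
- by exists (x1 - y1); rewrite ?rmorphB.
- by exists (x1 * y1); rewrite ?rmorphM.
- by exists x1^-1; rewrite ?fmorphV.
Qed.

Lemma finite_powerset (T : choiceType) (A : set T) :
  finite_set A -> finite_set [set U : set T | U `<=` A].
Proof.
move=> finA.
apply: (@sub_finite_set _ _
  ((fun Y : {fset T} => [set` Y]) @` [set` fpowerset (fset_set A)])).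
  move=> U /= UA; have finU := sub_finite_set UA finA.
  exists (fset_set U); last by rewrite fset_setK.
  by rewrite /= fpowersetE -fset_set_sub.
by apply: finite_image; apply: finite_fset.
Qed.

(** * Descent on the size of the conjugates *)

(** The constant 5 comes from [2 * n + 1 = 2 * k + 3 <= 5 * k], where
    [k = n - 1] is positive unless D is 0. *)
Lemma descent_bound (D n : nat) : (5 * D < n)%N ->
  (D * (2 * n).+1 <= n.-1 ^ 2)%N.
Proof.
case: n => // k; rewrite ltnS /= => Dk; case: D Dk => // D Dk.
have k_gt0 : (0 < k)%N by apply: leq_trans Dk.
apply: (@leq_trans (D.+1 * (5 * k))).
  by rewrite leq_mul2l /= mulnS (mulnDl 3 2 k) -addSn leq_add2r leq_pmulr.
by rewrite mulnCA mulnA expnS expn1 leq_mul2r Dk orbT.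
Qed.

Section Descent.
Variables (F K : fieldExtType rat) (h : {rmorphism F -> K}).
Variables (V : vectType F) (B : {symmetric V}) (L : set V) (m : nat).
Hypotheses (realK : totally_real K) (latL : is_lattice B L) (m_gt0 : (0 < m)%N).
Hypothesis univL : represents_all_multiples h B L m.
Variables (s : seq V) (N C : nat).
Hypotheses (N_gt0 : (0 < N)%N) (nz_s : {in s, forall f, f != 0}).
Hypothesis expB : forall v w, B v w = \sum_(f <- s) (B f f)^-1 * (B f v * B f w).
Hypothesis intN : {in s, forall f v, L v -> integers F (N%:R * B f v)}.
Hypothesis boundC : {in s, forall f, forall t : {rmorphism F -> algC},
  `|t (N%:R ^+ 2 * B f f)| <= C%:R}.

(** The shift by [n + 1] makes x totally positive while its conjugates stay at
    most [2 * n + 1]; each term of the resulting positive sum is then at most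
    [m * (2 * n + 1)], and C absorbs the coefficient. *)
Lemma descent (n : nat) (x : K) :
  (5 * (C * m) < n)%N -> integers K x ->
  (forall t : {rmorphism K -> algC}, `|t x| <= n%:R) ->
  exists y : V -> K,
    [/\ {in s, forall f, integers K (y f)},
        {in s, forall f (t : {rmorphism K -> algC}), `|t (y f)| <= n.-1%:R} &
        m%:R * (x + n.+1%:R) =
          \sum_(f <- s) h (N%:R ^+ 2 * B f f)^-1 * y f ^+ 2].
Proof.
move=> gt_n xint xn.
have tx_bounds (t : {rmorphism K -> algC}) : - n%:R <= t x <= n%:R.
  by have := xn t; rewrite real_ler_norml ?realK.
pose a := x + n.+1%:R.
have pos_a : positive_integers K a.
  split; first by apply: integersD => //; apply: integers_nat.
  move=> t _; have /andP[ge_n _] := tx_bounds t.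
  rewrite rmorphD rmorph_nat -natr1 addrA.
  by apply: ltr_wpDl; rewrite ?ltr01 // -lerBlDr sub0r.
have [w Lw Dw] : represents (ext_form h B) (ext_lattice h L) (m%:R * a).
  by apply: univL; exists a.
pose y f := N%:R * ext_pairing h B f w.
have Dma : m%:R * a = \sum_(f <- s) h (N%:R ^+ 2 * B f f)^-1 * y f ^+ 2.
  rewrite -Dw (ext_form_expansion h expB); apply: eq_bigr => f _.
  rewrite exprMn invfM rmorphM (fmorphV h (_ ^+ 2)) rmorphXn rmorph_nat.
  rewrite mulrACA mulVf ?mul1r // expf_neq0 //.
  by rewrite -(rmorph_nat (in_alg K)) fmorph_eq0 pnatr_eq0 -lt0n.
have pos_c (t : {rmorphism K -> algC}) f :
    f \in s -> 0 < t (h (N%:R ^+ 2 * B f f)).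
  move=> fs; rewrite (rmorphM h) (rmorphM t) !rmorphXn !rmorph_nat.
  rewrite mulr_gt0 ?exprn_gt0 ?ltr0n //.
  have real_th : real_embedding (t \o h : {rmorphism F -> algC}).
    by move=> z; apply: realK.
  exact: (lattice_posdef latL (nz_s fs) real_th).
have sqr_ge0 (t : {rmorphism K -> algC}) z : 0 <= t z ^+ 2.
  by rewrite real_exprn_even_ge0 ?realK.
exists y; split=> // [f fs|f fs t].
  by apply: ext_lattice_pairing Lw; apply: intN.
have le_ma : (t (h (N%:R ^+ 2 * B f f)))^-1 * t (y f) ^+ 2 <= m%:R * t a.
  have -> : m%:R * t a = t (m%:R * a) by rewrite rmorphM rmorph_nat.
  rewrite Dma rmorph_sum (big_rem f) //=.
  rewrite rmorphM (fmorphV h) (fmorphV t) rmorphXn lerDl.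
  rewrite big_seq sumr_ge0 // => f' /mem_rem f's.
  rewrite rmorphM rmorphXn (fmorphV h) (fmorphV t).
  by rewrite mulr_ge0 // invr_ge0 ltW ?pos_c.
rewrite ler_pdivrMl ?pos_c // in le_ma.
rewrite -(ler_pXn2r (n := 2)) ?nnegrE ?ler0n //.
rewrite real_normK ?realK //; apply: (le_trans le_ma).
apply: (@le_trans _ _ (C * m * (2 * n).+1)%:R); last first.
  by rewrite -natrX ler_nat descent_bound.
rewrite -mulnA natrM; apply: ler_pM.
- by rewrite ltW ?pos_c.
- by rewrite mulr_ge0 ?ler0n // ltW // pos_a.2 //; apply: realK.
- apply: (le_trans (real_ler_norm (realK t _))).
  exact: (boundC fs (t \o h : {rmorphism F -> algC})).
rewrite natrM ler_pM2l ?ltr0n // rmorphD rmorph_nat.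
rewrite mul2n -addnn -addnS natrD lerD2r.
by case/andP: (tx_bounds t).
Qed.

(** Strong induction on the bound n of the conjugates: below the threshold the
    integer belongs to S, and above it [descent] expresses the integer by F and
    integers with a smaller bound. Any element of K is an integer divided by a
    natural number. *)
Lemma generated_by_bounded_integers (iota : {rmorphism F -> algC})
    (j : {rmorphism K -> algC}) (S : set algC) :
  (forall x, j (h x) = iota x) -> range iota `<=` S ->
  (forall x, integers K x ->
    (forall t : {rmorphism K -> algC}, `|t x| <= (5 * (C * m))%:R) -> S (j x)) ->
  forall x, field_generated S (j x).
Proof.
move=> jh iotaS smallS.
have intG n : forall x, integers K x ->
    (forall t : {rmorphism K -> algC}, `|t x| <= n%:R) -> field_generated S (j x).
  elim/ltn_ind: n => n IHn x xint xn.
  have [le_n|gt_n] := leqP n (5 * (C * m)).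
    by apply/generated_mem/smallS => // t; rewrite (le_trans (xn t)) // ler_nat.
  have [y [yint yn Dx]] := descent gt_n xint xn.
  (* Undo the passage from x to m (x + n + 1). *)
  have -> : j x = m%:R^-1 * j (m%:R * (x + n.+1%:R)) - n.+1%:R.
    rewrite rmorphM rmorphD !rmorph_nat mulKf ?addrK //.
    by rewrite pnatr_eq0 -lt0n.
  apply: generated_sub; last exact: generated_nat.
  apply: generated_mul; first by apply/generated_inv/generated_nat.
  rewrite Dx rmorph_sum; apply: generated_sum => f fs /=.
  rewrite rmorphM rmorphXn jh; apply: generated_mul.
    by apply/generated_mem/iotaS; eexists.
  have Gy : field_generated S (j (y f)).
    apply: (IHn n.-1 _ _ (yint f fs)) => [|t]; last exact: yn.
    by rewrite ltn_predL (leq_ltn_trans _ gt_n).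
  by rewrite expr2; apply: generated_mul.
move=> x; have [M M_gt0 Mx] := integral_multiple x.
have [n nP] := embeddings_bounded (M%:R * x).
have -> : j x = M%:R^-1 * j (M%:R * x).
  by rewrite rmorphM rmorph_nat mulKf // pnatr_eq0 -lt0n.
by apply: generated_mul; [apply/generated_inv/generated_nat | apply: intG nP].
Qed.
End Descent.

(** * Finiteness of the fields *)

Theorem theorem2 (F : fieldExtType rat) (iota : {rmorphism F -> algC})
    (V : vectType F) (B : {symmetric V}) (L : set V) (d m : nat) :
  totally_real F -> is_lattice B L -> (0 < d)%N -> (0 < m)%N ->
  finite_set
    [set A : set algC |
      exists (K : fieldExtType rat) (j : {rmorphism K -> algC})
             (h : {rmorphism F -> K}),
        [/\ A = range j, forall x, j (h x) = iota x, totally_real K,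
            \dim {:K} = d & represents_all_multiples h B L m]].
Proof.
move=> realF latL _ m_gt0.
have anisotropic v : v != 0 -> B v v != 0.
  move=> nz_v; rewrite -(fmorph_eq0 iota).
  by rewrite gt_eqF // (lattice_posdef latL nz_v) //; apply: realF.
have [s nz_s expB] := orthogonal_expansion anisotropic.
have [N N_gt0 intN] := lattice_common_denominator B s (lattice_fg latL).
have [C boundC] := common_embeddings_bound [seq N%:R ^+ 2 * B f f | f <- s].
pose T := bounded_integers d (5 * (C * m)).
pose gen U := field_generated (range iota `|` U).
have finT : finite_set T by apply: bounded_integers_finite.
(* K is recovered from its elements in T as the field they generate over F. *)
apply: sub_finite_set (finite_image gen (finite_powerset finT)).
move=> _ [K [j [h [-> jh realK dimK univL]]]].
exists (T `&` range j) => /=; first by move=> z [].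
apply/seteqP; split.
  apply: field_generated_range => z [[x _ <-]|[_ //]].
  by exists (h x); rewrite ?jh.
move=> _ [x _ <-].
apply: (generated_by_bounded_integers realK latL m_gt0 univL N_gt0 nz_s expB intN
          (C := C) _ jh).
- by move=> f fs t; apply: boundC; apply/mapP; exists f.
- by move=> z; left.
move=> z zint zC; right; split; last by exists z.
split; first exact: integers_Aint.
  by rewrite -dimK size_minCpoly_leq.
by move=> r /conjugate_embedding[t <-]; apply: zC.
Qed.
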